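(* Let $k,\ell\ge1$, $\lambda\in\mathrm{Par}^k_\ell$, $z\in[\ell]$, $\mu=\lambda-\epsilon_z$, and $\Psi=\Delta^k(\mu)$. Let $c=|\mathrm{uppath}_\Psi(z)|$. If $z=\ell$, or $\lambda_z>\lambda_{z+1}$, or $\mathrm{up}_\Psi^c(z+1)$ is undefined, set $h=0$. Otherwise set $y+1=\mathrm{up}^c_\Psi(z+1)$ and let $h\in[\ell-z]$ be as large as possible such that $\mu$ is constant on each of the intervals $[z+1,z+h]$, $[x,x+h]$ for every $x\in\mathrm{uppath}_\Psi(z)\setminus\{z\}$, and $[y+1,y+h]$. Define $\mathrm{cvr}_z(\lambda)=\lambda+\epsilon_{[y+1,y+h]}-\epsilon_{[z,z+h]}$ (interpreting $[y+1,y+h]=\varnothing$ when $h=0$, so that $\mathrm{cvr}_z(\lambda)=\mu$ then). Then $$\mathfrak s^{(k)}_\mu=t^{hc}\,\mathfrak s^{(k)}_{\mathrm{cvr}_z(\lambda)},$$ and this is equal to $0$ if $\mathrm{cvr}_z(\lambda)\notin\mathrm{Par}^k_\ell$.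
   Context: $[a,b]=\{i\in\mathbb Z:a\le i\le b\}$, $[n]=[1,n]$; $\epsilon_i\in\mathbb Z^\ell$ standard basis vectors, $\epsilon_S=\sum_{i\in S}\epsilon_i$. For $\gamma\in\mathbb Z^\ell$, $s_\gamma=\det(h_{\gamma_i+j-i})_{1\le i,j\le\ell}$ ($h_0=1$, $h_d=0$ for $d<0$). $\Delta^+_\ell=\{(i,j):1\le i<j\le\ell\}$ with partial order $(a,b)\le(c,d)$ iff $a\ge c$ and $b\le d$; a root ideal is an upper order ideal. For $\Psi\subset\Delta^+_\ell$ and $\gamma\in\mathbb Z^\ell$, $H(\Psi;\gamma)$ is obtained by expanding $\prod_{(i,j)\in\Psi}(1-tz_i/z_j)^{-1}z^\gamma$ as a power series in $t$ and applying coefficientwise the linear map $z^\beta\mapsto s_\beta$. $\mathrm{Par}^k_\ell=\{\nu\in\mathbb Z^\ell:k\ge\nu_1\ge\dots\ge\nu_\ell\ge0\}$. For $\nu\in\mathbb Z^\ell$ with entries $\le k$, $\Delta^k(\nu)=\{(i,j)\in\Delta^+_\ell:k-\nu_i+i<j\}$ and $\mathfrak s^{(k)}_\nu=H(\Delta^k(\nu);\nu)$. A root $\alpha\in\Psi$ is removable if $\Psi\setminus\{\alpha\}$ is a root ideal. $\mathrm{up}_\Psi(x)=i$ if $(i,x)$ is a removable root of $\Psi$ (undefined otherwise); $\mathrm{up}^j_\Psi$ is its $j$-fold iterate. $\mathrm{uppath}_\Psi(x)=(x,\mathrm{up}_\Psi(x),\mathrm{up}^2_\Psi(x),\dots)$,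 continued as long as defined. *)

(* Defs.v *)
From mathcomp Require Import all_boot all_order all_algebra.
From mathcomp Require Export monalg.

Set Implicit Arguments.
Unset Strict Implicit.
Unset Printing Implicit Defensive.

Import GRing.Theory Num.Theory.
Local Open Scope ring_scope.

(* All indices are 0-based: the index i of [1, l] is the element i - 1 of
   'I_l.  Integer vectors of length l are row vectors g : 'rV[int]_l, with
   entries g 0 i. *)

(* The ring of symmetric functions, as the polynomial ring Z[h_1, h_2, ...];
   the variable of index d : nat stands for h_{d+1}. *)
Definition symfun := {malg int[{cmonom nat}]}.

Definition hsym (d : int) : symfun :=
  match d with
  | Posz 0 => 1
  | Posz d'.+1 => << ucm d' >>
  | Negz _ => 0
  end.

Definition schur l (g : 'rV[int]_l) : symfun :=
  \det (\matrix_(i < l, j < l) hsym (g 0 i + j%:Z - i%:Z)).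

(* Power series in t over symfun, as sequences of coefficients. *)
Definition tseries := nat -> symfun.

(* Multiplication by t ^ m. *)
Definition tmul (m : nat) (f : tseries) : tseries :=
  fun d => if (m <= d)%N then f (d - m)%N else 0.

Section Catalan.
Variable l : nat.
Implicit Types (Psi : {set 'I_l * 'I_l}) (g nu : 'rV[int]_l) (i j x : 'I_l).

Definition Delta_plus : {set 'I_l * 'I_l} :=
  [set a : 'I_l * 'I_l | (a.1 < a.2)%N].

Definition root_le (a b : 'I_l * 'I_l) : bool :=
  (b.1 <= a.1)%N && (a.2 <= b.2)%N.

Definition root_ideal Psi : bool :=
  (Psi \subset Delta_plus) &&
  [forall a in Psi, forall b in Delta_plus, root_le a b ==> (b \in Psi)].

Definition root_vec (a : 'I_l * 'I_l) : 'rV[int]_l :=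
  delta_mx 0 a.1 - delta_mx 0 a.2.

(* The multiplicity functions on Psi of total weight d: replacing each factor
   (1 - t z_i / z_j)^-1 by its geometric series
   \sum_m t ^ m (z_i / z_j) ^ m and multiplying out, they index the monomials
   in the coefficient of t ^ d. *)
Definition mults Psi (d : nat) : {set {ffun 'I_l * 'I_l -> 'I_d.+1}} :=
  [set m : {ffun 'I_l * 'I_l -> 'I_d.+1} |
    [forall a, (a \notin Psi) ==> (m a == ord0)] &&
    (\sum_(a in Psi) m a == d)%N].

(* H(Psi; g), given by its coefficient of t ^ d. *)
Definition catalan Psi g : tseries := fun d =>
  \sum_(m in mults Psi d) schur (g + \sum_(a in Psi) root_vec a *+ m a).

Definition Par (k : nat) nu : bool :=
  [forall i : 'I_l, (0 <= nu 0 i <= k%:Z)] &&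
  [forall i : 'I_l, forall j : 'I_l, (i <= j)%N ==> (nu 0 j <= nu 0 i)].

Definition Delta (k : nat) nu : {set 'I_l * 'I_l} :=
  [set a in Delta_plus | k%:Z - nu 0 a.1 + a.1%:Z < a.2%:Z].

Definition kschur (k : nat) nu : tseries := catalan (Delta k nu) nu.

Definition removable Psi (a : 'I_l * 'I_l) : bool :=
  (a \in Psi) && root_ideal (Psi :\ a).

(* A root ideal has at most one removable root in each column x. *)
Definition up Psi x : option 'I_l := [pick i | removable Psi (i, x)].

Definition up_iter Psi (n : nat) x : option 'I_l :=
  iter n (obind (up Psi)) (Some x).

(* up Psi x < x whenever it is defined, so the iterates of order >= l are all
   undefined. *)
Definition uppath Psi x : seq 'I_l :=
  pmap (fun n => up_iter Psi n x) (iota 0 l).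

(* Intervals of indices are half-open: [a, b) is given by a and b. *)
Definition eps (a b : nat) : 'rV[int]_l :=
  \row_i (a <= i < b)%N%:R.

Definition const_on g (a b : nat) : bool :=
  [forall i : 'I_l, forall j : 'I_l, (a <= i < b)%N && (a <= j < b)%N ==> (g 0 i == g 0 j)].

Section Cover.
Variables (k : nat) (lam : 'rV[int]_l) (z : 'I_l).

Definition cvr_mu : 'rV[int]_l := lam - delta_mx 0 z.

Definition cvr_ideal : {set 'I_l * 'I_l} := Delta k cvr_mu.

Definition cvr_c : nat := size (uppath cvr_ideal z).

(* The index called y + 1 in the definition of the cover; None in the cases
   where h is set to 0: z last, lam_z > lam_{z+1}, or up^c (z + 1)
   undefined. *)
Definition cvr_y1 : option 'I_l :=
  if insub z.+1 is Some z1 then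
    if lam 0 z1 < lam 0 z then None else up_iter cvr_ideal cvr_c z1
  else None.

Definition cvr_h_ok (y1 : 'I_l) (h : nat) : bool :=
  [&& (1 <= h <= l - z.+1)%N,
      const_on cvr_mu z.+1 (z + h).+1,
      all (fun x : 'I_l => const_on cvr_mu x (x + h).+1)
          [seq x <- uppath cvr_ideal z | x != z]
    & const_on cvr_mu y1 (y1 + h)].

Definition cvr_h : nat :=
  if cvr_y1 is Some y1 then (\max_(h < l | cvr_h_ok y1 h) h)%N else 0%N.

Definition cvr : 'rV[int]_l :=
  lam + (if cvr_y1 is Some y1 then eps y1 (y1 + cvr_h) else 0)
      - eps z (z + cvr_h).+1.

End Cover.
End Catalan.

(* Main.v *)
Require Import Defs.
From mathcomp Require Import all_boot all_order all_algebra.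
From mathcomp Require Import perm zify.

(* A staircase S, giving the first column of each row, encodes the root ideal
   {(i, j) : S i <= j}.  Two relations are used.  Splitting off the first root
   (i, w) of row i gives H(S; g) = H(S minus (i, w); g) + t H(S; g + e_i - e_w).
   If rows x, x+1 have the same first column and no row starts in column x+1,
   then the product over the ideal is symmetric in z_x, z_(x+1), so straightening
   of Schur functions gives H(S; g) = - H(S; g') with g' obtained from g by
   (g_x, g_(x+1)) -> (g_(x+1) - 1, g_x + 1); in particular H(S; g) = 0 when
   g_(x+1) = g_x + 1.
   Let z = x_0 > x_1 > ... > x_(c-1) be the bounce path and suppose that rows
   x_i, x_i + 1 start in columns x_(i-1), x_(i-1) + 1.  If no row starts in
   column x_(c-1) + 1, the roots (x_i + 1, x_(i-1)) can be added one by one from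
   the top without changing H, until the vanishing criterion applies at z.  If
   row y+1 starts in column x_(c-1) + 1, adding (y+1, x_(c-1)) yields - t times a
   term in which the -1 moves down the path, from x_(c-1) to z, at the cost of a
   factor t at each step; the antisymmetry at z then turns g - e_z into
   - (g - e_(z+1)).  Hence H(mu) = t^c H(mu + e_(y+1) - e_(z+1)), and this is
   iterated h times along the shifted paths x_i + s.  After the last step the
   weight either is a partition, or ends with a negative entry, or has an ascent
   at z + h; in that case maximality of h breaks the shifted path at some place,
   and the vanishing criterion applies to the part of the path below it. *)

Set Implicit Arguments.
Unset Strict Implicit.
Unset Printing Implicit Defensive.
Import GRing.Theory Num.Theory.
Local Open Scope ring_scope.

(** * Catalan functions of arbitrary root sets *)

Lemma symfun_double0 (f : symfun) : f = - f -> f = 0.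
Proof.
move=> ff; apply/malgP => m; rewrite mcoeff0.
have := congr1 (mcoeff m) ff; rewrite mcoeffN; lia.
Qed.

(** Exchanging rows [x] and [x1] of the determinant changes its sign; the corrections by 1 absorb
    the term [- i] in the index of [hsym]. *)
Lemma schur_swap l (g g' : 'rV[int]_l) (x x1 : 'I_l) :
    x1 = x.+1 :> nat -> g' 0 x = g 0 x1 - 1 -> g' 0 x1 = g 0 x + 1 ->
    (forall i, i != x -> i != x1 -> g' 0 i = g 0 i) ->
  schur g' = - schur g.
Proof.
move=> x1E gx gx1 gi.
have xx1 : x != x1 by rewrite -val_eqE /= x1E; lia.
rewrite /schur; set A := (X in _ = - \det X).
transitivity ((-1) ^+ tperm x x1 * \det A); last by rewrite odd_tperm xx1 mulN1r.
rewrite -det_perm -det_mulmx; congr (\det _).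
rewrite -row_permE; apply/matrixP => i j; rewrite !mxE.
congr hsym; case: tpermP => [->|->|/eqP ix /eqP ix1].
- by rewrite gx x1E; lia.
- by rewrite gx1 x1E; lia.
- by rewrite gi.
Qed.

(** All indices in the last row are at most [g 0 x], hence negative, and the row is zero. *)
Lemma schur_last_neg l (g : 'rV[int]_l) (x : 'I_l) :
  x = l.-1 :> nat -> g 0 x < 0 -> schur g = 0.
Proof.
move=> xl gx; rewrite /schur (expand_det_row _ x) big1 // => j _.
rewrite mxE; have := ltn_ord j.
case E: (g 0 x + _ - _) => [[|n]|n]; rewrite ?mul0r //; lia.
Qed.

Lemma sum_split (V : nmodType) (I : finType) (P a : pred I) (F : I -> V) x y :
    \sum_(i | P i && a i) F i = x -> \sum_(i | P i && ~~ a i) F i = y ->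
  \sum_(i | P i) F i = x + y.
Proof. by move=> <- <-; exact: bigID. Qed.

Section Catalan.
Variable l : nat.
Implicit Types (Psi : {set 'I_l * 'I_l}) (g : 'rV[int]_l).

Lemma multsP Psi d (m : {ffun 'I_l * 'I_l -> 'I_d.+1}) :
  reflect ((forall a, a \notin Psi -> m a = ord0) /\ (\sum_(a in Psi) m a = d)%N)
          (m \in mults Psi d).
Proof.
rewrite inE; apply: (iffP andP) => -[h1 /eqP h2]; split=> //.
- by move=> a aP; move/forallP/(_ a): h1; rewrite aP => /eqP.
- by apply/forallP => a; apply/implyP => aP; rewrite h1.
Qed.

(** This is (1 - q)^-1 = 1 + q (1 - q)^-1 for the factor of [b]: the two summands collect the
    multiplicity functions with [m b] zero and nonzero. *)
Lemma catalan_expand Psi g (b : 'I_l * 'I_l) d : b \in Psi ->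
  catalan Psi g d = catalan (Psi :\ b) g d + tmul 1 (catalan Psi (g + root_vec b)) d.
Proof.
move=> bP; rewrite {1}/catalan.
apply: (sum_split (a := fun m : {ffun 'I_l * 'I_l -> 'I_d.+1} => m b == ord0)).
  apply: eq_big => [m|m /andP[_ /eqP mb]].
    apply/andP/multsP => [[/multsP[h1 h2] /eqP h3]|[h1 h2]].
      split=> [a|]; first by rewrite !inE negb_and negbK => /orP[/eqP->|/h1].
      by move: h2; rewrite (big_setD1 b) //= h3.
    have mb : m b = ord0 by apply: h1; rewrite !inE eqxx.
    split; last exact/eqP.
    apply/multsP; split=> [a aP|]; first by apply: h1; rewrite !inE negb_and aP orbT.
    by rewrite (big_setD1 b) //= mb.
  congr (schur (_ + _)); apply: etrans (big_setD1 b bP) _.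
  by rewrite mb mulr0n /= add0r.
case: d => [|d]; rewrite /tmul /=.
  by rewrite big1 // => m /andP[_]; rewrite (ord1 (m b)) eqxx.
rewrite subn1 /=.
(* The multiplicity functions with [m b] nonzero are reindexed by lowering [m b] by one. The total
   weight, and with it the bound in the codomain, drops by one; the bound holds at [a] other than
   [b] because [m a + m b] is at most [d.+1]. *)
pose up (m : {ffun 'I_l * 'I_l -> 'I_d.+1}) : {ffun 'I_l * 'I_l -> 'I_d.+2} :=
  [ffun a => inord (m a + (a == b))].
pose down (m : {ffun 'I_l * 'I_l -> 'I_d.+2}) : {ffun 'I_l * 'I_l -> 'I_d.+1} :=
  [ffun a => inord (m a - (a == b))].
have upE m a : up m a = (m a + (a == b))%N :> nat.
  by rewrite ffunE inordK //; have := ltn_ord (m a); case: (a == b); lia.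
have downE m a : m \in mults Psi d.+1 -> m b != ord0 -> down m a = (m a - (a == b))%N :> nat.
  move=> /multsP[h1 h2] mb; rewrite ffunE inordK //.
  case: eqP => [->|/eqP ab] /=; first by have := ltn_ord (m b); move: mb; rewrite -val_eqE /=; lia.
  case: (boolP (a \in Psi)) => [aP|/h1->] //=.
  move: h2 mb; rewrite (big_setD1 b) //= (big_setD1 a) ?inE ?ab //= -val_eqE /=; lia.
rewrite (reindex_onto up down) /=; last first.
  move=> m /andP[mP mb]; apply/ffunP => a; apply: val_inj.
  rewrite /= upE downE //; case: eqP => [->|_] /=; last lia.
  by move: mb; rewrite -val_eqE /=; lia.
have sumup m : (\sum_(a in Psi) up m a = \sum_(a in Psi) m a + 1)%N.
  rewrite (big_setD1 b) //= [X in (_ = X + _)%N](big_setD1 b) //= upE eqxx.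
  rewrite (eq_bigr (fun a => m a : nat)) => [|a]; last first.
    by rewrite !inE upE => /andP[/negbTE-> _]; rewrite addn0.
  by rewrite addnAC.
apply: eq_big => [m|m _].
  apply/andP/multsP => [[/andP[/multsP[h1 h2] h3] /eqP h4]|[h1 h2]].
    split=> [a aP|]; last by move: h2; rewrite sumup addn1 => -[].
    by apply: val_inj; have := congr1 val (h1 _ aP); rewrite /= upE; lia.
  have bup : up m b != ord0 by rewrite -val_eqE /= upE eqxx addn1.
  have upP : up m \in mults Psi d.+1.
    apply/multsP; split=> [a aP|]; last by rewrite sumup h2 addn1.
    apply: val_inj; rewrite /= upE h1 //=.
    by case: eqP aP => // ->; rewrite bP.
  split; first by rewrite upP.
  by apply/eqP/ffunP => a; apply: val_inj; rewrite /= downE // upE addnK.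
congr schur; rewrite -addrA; congr (_ + _).
rewrite !(big_setD1 b bP) /= addrA upE eqxx addn1 mulrS.
congr (_ + _); apply: eq_bigr => a; rewrite !inE upE => /andP[/negbTE-> _].
by rewrite addn0.
Qed.

Definition swap_root (x x1 : 'I_l) (a : 'I_l * 'I_l) := (tperm x x1 a.1, tperm x x1 a.2).

Lemma swap_rootK x x1 : involutive (swap_root x x1).
Proof. by case=> i j; rewrite /swap_root /= !tpermK. Qed.

(** The transposition permutes the roots of [Psi], so it acts on multiplicity functions; after
    reindexing by it, the sums differ termwise by [schur_swap]. *)
Lemma catalan_swap Psi g g' (x x1 : 'I_l) d :
    x1 = x.+1 :> nat -> (forall a, (swap_root x x1 a \in Psi) = (a \in Psi)) ->
    g' 0 x = g 0 x1 - 1 -> g' 0 x1 = g 0 x + 1 ->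
    (forall i, i != x -> i != x1 -> g' 0 i = g 0 i) ->
  catalan Psi g' d = - catalan Psi g d.
Proof.
move=> x1E sP gx gx1 gi; rewrite /catalan -sumrN.
pose sw (m : {ffun 'I_l * 'I_l -> 'I_d.+1}) : {ffun 'I_l * 'I_l -> 'I_d.+1} :=
  [ffun a => m (swap_root x x1 a)].
have swK : involutive sw by move=> m; apply/ffunP => a; rewrite !ffunE swap_rootK.
rewrite (reindex_inj (inv_inj swK)) /=; apply: eq_big => [m|m _].
  apply/multsP/multsP => -[h1 h2]; split.
  - by move=> a aP; have := h1 (swap_root x x1 a); rewrite sP ffunE swap_rootK; apply.
  - move: h2; rewrite (reindex_inj (inv_inj (@swap_rootK x x1))) /=.
    by under eq_big => [a|a _] do [rewrite sP|rewrite ffunE swap_rootK].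
  - by move=> a aP; rewrite ffunE; apply: h1; rewrite sP.
  - rewrite (reindex_inj (inv_inj (@swap_rootK x x1))) /=.
    by under eq_big => [a|a _] do [rewrite sP|rewrite ffunE swap_rootK].
have wE (i : 'I_l) : (\sum_(a in Psi) root_vec a *+ sw m a) 0 i =
                     (\sum_(a in Psi) root_vec a *+ m a) 0 (tperm x x1 i).
  rewrite !summxE (reindex_inj (inv_inj (@swap_rootK x x1))) /=.
  apply: eq_big => [a|a _]; first by rewrite sP.
  rewrite ffunE swap_rootK /root_vec -!scaler_nat !mxE /=.
  by rewrite !(can2_eq (tpermK _ _) (tpermK _ _)).
apply: (@schur_swap _ _ _ x x1) => //; rewrite ?mxE ?wE ?tpermL ?tpermR ?gx ?gx1.
- by rewrite addrAC.
- by rewrite addrAC.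
move=> i ix ix1; rewrite !mxE wE gi // tpermD //; by rewrite eq_sym.
Qed.

(** A positive root never has the last index as its first component, so adding roots only lowers the
    last entry and every Schur function in the sum vanishes. *)
Lemma catalan_last_neg Psi g (x : 'I_l) d :
  Psi \subset Delta_plus l -> x = l.-1 :> nat -> g 0 x < 0 -> catalan Psi g d = 0.
Proof.
move=> PD xl gx; rewrite /catalan big1 // => m _.
apply: (@schur_last_neg _ _ x) => //; rewrite !mxE summxE.
rewrite -[ltRHS](addr0 0); apply: ltr_leD => //; apply: sumr_le0 => a /(subsetP PD).
rewrite inE => aD; rewrite /root_vec -scaler_nat !mxE /=.
have -> : (x == a.1) = false.
  by apply/eqP => xa; have := ltn_ord a.2; move: aD xl; rewrite -xa /=; lia.
by rewrite add0r mulrN oppr_le0 mulr_ge0 ?ler0n.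
Qed.
End Catalan.

(** * Staircases *)

Lemma tmulD m n f d : tmul m (tmul n f) d = tmul (m + n) f d.
Proof.
rewrite /tmul; case: (leqP m d) => md; last by rewrite ifF //; lia.
case: (leqP n (d - m)) => nd; last by rewrite ifF //; lia.
by rewrite ifT ?subnDA //; lia.
Qed.

Lemma eq_tmul m f f' : f =1 f' -> tmul m f =1 tmul m f'.
Proof. by move=> ff d; rewrite /tmul; case: ifP => // _; rewrite ff. Qed.

Lemma tmulN m f f' : (forall d, f d = - f' d) -> forall d, tmul m f d = - tmul m f' d.
Proof. by move=> ff d; rewrite /tmul; case: ifP => // _; rewrite oppr0. Qed.

Lemma tmul0 m f : (forall d, f d = 0) -> forall d, tmul m f d = 0.
Proof. by move=> ff d; rewrite /tmul; case: ifP. Qed.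

Definition upd (S : nat -> nat) i v : nat -> nat := fun j => if j == i then v else S j.

Definition shift (g : nat -> int) i w : nat -> int :=
  fun j => g j + (j == i : nat)%:Z - (j == w : nat)%:Z.

Definition lower (g : nat -> int) w : nat -> int := fun j => g j - (j == w : nat)%:Z.

Section Staircase.
Variable l : nat.
Implicit Types (S : nat -> nat) (g : nat -> int).

(** Starts and weights are functions on all of [nat], so that indices such as [x.+1] need no bound
    proof; a start at [l] or beyond encodes an empty row. *)
Definition staircase S : {set 'I_l * 'I_l} := [set a : 'I_l * 'I_l | (S a.1 <= a.2)%N].

Definition rowfun g : 'rV[int]_l := \row_i g i.

(* Locked, as conversion would otherwise try to compute in the algebra. *)
Fact Hstair_key : unit. Proof. by []. Qed.
Definition Hstair : (nat -> nat) -> (nat -> int) -> tseries :=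
  locked_with Hstair_key (fun S g => catalan (staircase S) (rowfun g)).

Lemma HstairE S g : Hstair S g = catalan (staircase S) (rowfun g).
Proof. by rewrite /Hstair unlock. Qed.

Lemma eq_Hstair S S' g g' d :
    (forall i, i < l -> S i = S' i \/ (l <= S i /\ l <= S' i))%N ->
    (forall i, (i < l)%N -> g i = g' i) ->
  Hstair S g d = Hstair S' g' d.
Proof.
move=> SS gg; rewrite !HstairE; congr (catalan _ _ d).
  apply/setP => -[i j]; rewrite !inE /=.
  by have := ltn_ord j; case: (SS i (ltn_ord i)) => [->|] //; lia.
by apply/rowP => i; rewrite !mxE gg.
Qed.

Lemma Hstair_swap S g g' x d :
    (x.+1 < l)%N -> S x = S x.+1 -> (forall r, (r < l)%N -> S r <> x.+1) ->
    g' x = g x.+1 - 1 -> g' x.+1 = g x + 1 ->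
    (forall i, i != x -> i != x.+1 -> g' i = g i) ->
  Hstair S g' d = - Hstair S g d.
Proof.
move=> x1l Sx Sr gx gx1 gi; rewrite !HstairE.
have xl : (x < l)%N by lia.
apply: (@catalan_swap _ _ _ _ (Ordinal xl) (Ordinal x1l)); rewrite ?mxE //=.
- have row i : S (tperm (Ordinal xl) (Ordinal x1l) i) = S i.
    by case: tpermP => [->|->|].
  have col (r j : 'I_l) : (S r <= tperm (Ordinal xl) (Ordinal x1l) j)%N = (S r <= j)%N.
    by have := Sr r (ltn_ord r); case: tpermP => [->|->|] //=; lia.
  by case=> i j; rewrite !inE /= row col.
- move=> i; rewrite -!val_eqE /= => ix ix1; rewrite !mxE; exact: gi.
Qed.

Lemma Hstair_eq0 S g x d :
    (x.+1 < l)%N -> S x = S x.+1 -> (forall r, (r < l)%N -> S r <> x.+1) ->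
    g x.+1 = g x + 1 ->
  Hstair S g d = 0.
Proof.
move=> x1l Sx Sr gx; apply: symfun_double0; apply: (Hstair_swap (x := x)) => //; lia.
Qed.

Lemma Hstair_expand S g i w d : (i < l)%N -> (w < l)%N -> S i = w ->
  Hstair S g d = Hstair (upd S i w.+1) g d + tmul 1 (Hstair S (shift g i w)) d.
Proof.
move=> il wl Si; rewrite [in LHS]HstairE.
rewrite (@catalan_expand _ _ _ (Ordinal il, Ordinal wl)); last by rewrite inE /= Si.
apply: (f_equal2 (fun a b : symfun => a + b)).
  rewrite !HstairE; congr (catalan _ _ d); apply/setP => -[a b].
  rewrite !inE xpair_eqE -!val_eqE /= /upd; case: (a =P i :> nat) => [->|_] //=.
  by rewrite Si; lia.
apply: eq_tmul => {}d; rewrite !HstairE; congr (catalan _ _ d).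
apply/rowP => j; rewrite !mxE -!val_eqE /= /shift.
by case: (_ == _); case: (_ == _); lia.
Qed.

(** Adding the root [(x.+1, w)] makes rows [x] and [x.+1] level. The extra term of the expansion
    carries an ascent by one there, so it vanishes. *)
Lemma Hstair_toggle S g x w d :
    (x.+1 < l)%N -> S x = w -> S x.+1 = w.+1 -> (x.+1 < w)%N ->
    (forall r, (r < l)%N -> S r <> x.+1) -> g x = g x.+1 ->
  Hstair S g d = Hstair (upd S x.+1 w) g d.
Proof.
move=> x1l Sx Sx1 xw Sr gx.
(* For [w >= l] the row [x.+1] is empty before and after the change. *)
case: (ltnP w l) => wl; last first.
  by apply: eq_Hstair => // i _; rewrite /upd; case: eqP => [->|]; lia.
rewrite [RHS](@Hstair_expand _ _ x.+1 w) //; last by rewrite /upd eqxx.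
rewrite tmul0 ?addr0 => [|e].
  by apply: eq_Hstair => // i _; left; rewrite /upd; case: eqP => // ->.
apply: (Hstair_eq0 (x := x)) => //.
- by rewrite /upd eqxx ifF //; lia.
- by move=> r /Sr; rewrite /upd; case: eqP; lia.
- by rewrite /shift; lia.
Qed.

(* The chain x :: xs runs down the ideal: it is the reverse of (part of) a bounce path. *)
Fixpoint mirrored S g x xs : Prop :=
  if xs is b :: xs' then
    [/\ S x = b, S x.+1 = b.+1, (x.+1 < b)%N, g x = g x.+1
      & forall r, (r < l)%N -> S r = b.+1 -> r = x.+1] /\ mirrored S g b xs'
  else (x.+1 < l)%N.

(** At each link, row [x.+1] is made level with row [x]; this vacates column [b.+1], which is what
    the next link requires. *)
Fixpoint toggled S x xs : nat -> nat :=
  if xs is b :: xs' then toggled (upd S x.+1 b) b xs' else S.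

Lemma mirrored_last S g x xs : mirrored S g x xs -> (x <= last x xs)%N /\ ((last x xs).+1 < l)%N.
Proof.
by elim: xs x => [|b xs IH] x //= [[_ _ xb _ _]] /IH[]; split=> //; lia.
Qed.

(** Being mirrored depends on the rows from [x] up to the end of the chain and on which rows start
    in a column [b.+1]. The three alternatives for [S' r] prevent a changed row from starting in
    such a column. *)
Lemma eq_mirrored S g S' g' x xs :
    mirrored S g x xs ->
    (forall r, x <= r < last x xs -> S' r = S r)%N ->
    (forall r, r < l -> [\/ S' r = S r, S' r <= x | last x xs < S' r - 1])%N ->
    (forall r, (x <= r < last x xs)%N -> g' r = g r) ->
  mirrored S' g' x xs.
Proof.
elim: xs x => [|b xs IH] x //= [[Sx Sx1 xb gx Su] m] Sr Sr' gr.
have [bl _] := mirrored_last m.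
split; last first.
  apply: IH => // r rr; [apply: Sr|case: (Sr' r rr)|apply: gr]; try lia.
  - by constructor 1.
  - by constructor 2; lia.
  - by constructor 3.
split=> //; rewrite ?Sr ?gr //; try lia.
move=> r rl Sb; apply: Su => //; case: (Sr' r rl) => //; lia.
Qed.

(** The toggled rows lie strictly between [x] and the end of the chain. *)
Lemma toggled_id S x xs g r : mirrored S g x xs -> (r <= x)%N || (last x xs <= r)%N ->
  toggled S x xs r = S r.
Proof.
elim: xs S x => [|b xs IH] S x //= [[Sx Sx1 xb gx Su] m] rx.
have [bl _] := mirrored_last m.
rewrite IH; first by rewrite /upd ifF //; lia.
  apply: (eq_mirrored m) => // i ii; rewrite /upd; case: eqP => // ie; try lia.
  - by constructor 2.
  - by constructor 1.
by lia.
Qed.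

Lemma mirrored_tail S g x b xs : mirrored S g x (b :: xs) ->
  mirrored (upd S x.+1 b) g b xs.
Proof.
move=> [[Sx Sx1 xb gx Su] m].
apply: (eq_mirrored m) => // i ii; rewrite /upd; case: eqP => // ie; try lia.
- by constructor 2.
- by constructor 1.
Qed.

Lemma ceiling_tail S g x b xs : mirrored S g x (b :: xs) ->
  forall r, (r < l)%N -> upd S x.+1 b r <> b.+1.
Proof.
move=> [[Sx Sx1 xb gx Su] m] r rl; rewrite /upd; case: eqP; try lia.
by move=> rx /(Su _ rl).
Qed.

Lemma toggled_ceiling S g x xs : mirrored S g x xs ->
    (forall r, (r < l)%N -> S r <> x.+1) ->
  forall r, (r < l)%N -> toggled S x xs r <> (last x xs).+1.
Proof.
elim: xs S x => [|b xs IH] S x // m Sr r rl /=.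
exact: IH (mirrored_tail m) (ceiling_tail m) _ rl.
Qed.

Lemma toggled_upd S x xs g v i z : mirrored S g x xs -> (last x xs <= z)%N ->
  toggled (upd S z v) x xs i = upd (toggled S x xs) z v i.
Proof.
move=> m; elim: xs S x m i => [|b xs IH] S x //= m i lz.
have [bl _] := mirrored_last m.2; case: (m) => -[_ _ xb _ _] _.
rewrite -(IH (upd S x.+1 b)) //; last exact: mirrored_tail.
(* The two updates commute only pointwise, so [toggled] must be shown to respect pointwise
   equality. *)
suff eq_toggled S1 S2 y ys : S1 =1 S2 -> toggled S1 y ys =1 toggled S2 y ys.
  by apply: eq_toggled => j; rewrite /upd; case: eqP => // jx; rewrite ifF //; lia.
elim: ys S1 S2 y => [|c ys IHy] S1 S2 y //= SS; apply: IHy => j.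
by rewrite /upd SS.
Qed.

Lemma Hstair_toggled S g x xs d : mirrored S g x xs ->
    (forall r, (r < l)%N -> S r <> x.+1) ->
  Hstair S g d = Hstair (toggled S x xs) g d.
Proof.
elim: xs S x => [|b xs IH] S x // m Sr /=.
rewrite -IH; [|exact: mirrored_tail|exact: ceiling_tail m].
have [_ bl] := mirrored_last m; case: (m) => -[Sx Sx1 xb gx Su] mb.
have [lb _] := mirrored_last mb.
apply: Hstair_toggle => //; move: bl lb => /=; lia.
Qed.

Lemma Hstair_mirrored_eq0 S g x xs d : mirrored S g x xs ->
    (forall r, (r < l)%N -> S r <> x.+1) ->
    S (last x xs) = S (last x xs).+1 -> g (last x xs).+1 = g (last x xs) + 1 ->
  Hstair S g d = 0.
Proof.
move=> m Sr Sz gz; rewrite (Hstair_toggled _ m) //.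
have [_ bl] := mirrored_last m.
apply: (Hstair_eq0 (x := last x xs)) => //; last exact: toggled_ceiling m Sr.
by rewrite !(toggled_id m) ?leqnSn ?leqnn ?orbT.
Qed.

(** Expand at the first root [(x, b)] of row [x]. Without this root, rows [x] and [x.+1] are level
    and the lowered weight ascends by one, so that term vanishes; in the other the -1 has moved from
    [x] to [b] at the cost of a factor t. *)
Lemma Hstair_lower S g x xs d : mirrored S g x xs ->
    (forall r, (r < l)%N -> S r <> x.+1) ->
  Hstair S (lower g x) d = tmul (size xs) (Hstair (toggled S x xs) (lower g (last x xs))) d.
Proof.
elim: xs S x d => [|b xs IH] S x d m Sr /=.
  by rewrite /tmul /= subn0.
have [_ bl] := mirrored_last m; case: (m) => -[Sx Sx1 xb gx Su] mb.
have [lb _] := mirrored_last mb.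
rewrite (@Hstair_expand _ _ x b) //; try by move: bl lb => /=; lia.
rewrite (Hstair_eq0 (x := x)) ?add0r.
- rewrite -[(size xs).+1]add1n -tmulD; apply: eq_tmul => {}d.
  rewrite -IH; [|exact: mirrored_tail|exact: ceiling_tail m].
  transitivity (Hstair S (lower g b) d).
    by apply: eq_Hstair => [|j _]; [left|rewrite /shift /lower; lia].
  apply: Hstair_toggle => //; first by move: bl lb => /=; lia.
  by rewrite /lower; lia.
- by move: bl lb => /=; lia.
- by rewrite /upd eqxx ifF ?Sx1 //; lia.
- by move=> r /Sr; rewrite /upd; case: eqP; lia.
- by rewrite /lower; lia.
Qed.

Lemma Hstair_straighten S g x xs y d (z := last x xs) :
    (y < x)%N -> S y = x.+1 -> (forall r, (r < l)%N -> S r = x.+1 -> r = y) ->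
    mirrored S g x xs -> S z = S z.+1 -> (z.+1 < S z)%N -> g z.+1 = g z + 1 ->
  Hstair S g d =
  tmul (size xs).+1 (Hstair (upd (upd S y x) z.+1 (S z).+1) (shift g y z.+1)) d.
Proof.
move=> yx Sy Su m Sz zSz gz.
(* [S1] adds the root [(y, x)], which clears column [x.+1]; [S2] also removes the first root of row
   [z.+1]. The weight with the -1 at position j is [lower g0 j], and [g'] is the final weight. *)
have [xz zl] := mirrored_last m; rewrite -/z in xz zl.
pose S1 := upd S y x; pose S2 := upd S1 z.+1 (S z).+1; pose g' := shift g y z.+1.
pose g0 : nat -> int := fun j => g j + (j == y : nat)%:Z.
have S1x r : (r < l)%N -> S1 r <> x.+1.
  by move=> rl; rewrite /S1 /upd; case: eqP => [|ry /(Su _ rl)] //; lia.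
have mS1 h : (forall r, (x <= r < z)%N -> h r = g r) -> mirrored S1 h x xs.
  move=> hg; apply: (eq_mirrored m) => // r rr.
    by rewrite /S1 /upd ifF //; lia.
  by rewrite /S1 /upd; case: eqP => _; [constructor 2|constructor 1].
have S1z : S1 z = S z by rewrite /S1 /upd ifF //; lia.
have S1z1 : S1 z.+1 = S z by rewrite /S1 /upd ifF //; lia.
(* For [S1] and [g] the vanishing criterion holds; expanding this zero at [(y, x)] gives the first
   factor - t. *)
have -> : Hstair S g d = - tmul 1 (Hstair S1 (lower g0 x)) d.
  have := Hstair_mirrored_eq0 d (mS1 g (fun=> fun=> erefl)) S1x.
  rewrite -/z S1z S1z1 => /(_ erefl gz).
  rewrite (@Hstair_expand _ _ y x) //; try lia; last by rewrite /S1 /upd eqxx.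
  move=> /eqP; rewrite addr_eq0 => /eqP E.
  rewrite -[LHS](_ : Hstair (upd S1 y x.+1) g d = _).
    by rewrite E.
  by apply: eq_Hstair => // i _; left; rewrite /S1 /upd; case: eqP => // ->.
rewrite -[(size xs).+1]add1n -tmulD.
symmetry; apply: tmulN => {}d.
rewrite (Hstair_lower d (mS1 g0 _)) //; last by move=> r rr; rewrite /g0; lia.
rewrite -/z; apply: tmulN => {}d.
have tz : toggled S1 x xs z = S z by rewrite (toggled_id (mS1 g _)) ?S1z // -/z leqnn orbT.
have tz1 : toggled S1 x xs z.+1 = S z by rewrite (toggled_id (mS1 g _)) ?S1z1 // -/z leqnSn orbT.
(* Antisymmetry at [z] sends [lower g0 z] to [g']; its sign cancels the earlier one. *)
rewrite [in RHS](Hstair_swap (x := z) (g := g')) ?tz ?tz1 //; first last.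
- by move=> i iz iz1; rewrite /lower /g0 /g' /shift; lia.
- by rewrite /lower /g0 /g' /shift; lia.
- by rewrite /lower /g0 /g' /shift; lia.
- exact: (toggled_ceiling (mS1 g _)).
rewrite opprK.
(* It remains to undo the toggles. Since [g'] takes equal values at [z] and [z.+1], one more toggle
   matches the level rows there with those of [S2]. *)
have mS2 : mirrored S2 g' x xs.
  apply: (eq_mirrored (mS1 g _)) => // r rr; rewrite -/z in rr *.
  - by rewrite /S2 /upd ifF //; lia.
  - rewrite /S2 /upd; case: eqP => _; [constructor 3; lia|by constructor 1].
  - by rewrite /g' /shift; lia.
have S2x r : (r < l)%N -> S2 r <> x.+1.
  by move=> /S1x; rewrite /S2 /upd; case: eqP; lia.
rewrite -/S1 -/S2 -/g' (Hstair_toggled d mS2 S2x).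
have t2 i : toggled S2 x xs i = upd (toggled S1 x xs) z.+1 (S z).+1 i.
  by apply: (toggled_upd _ _ (mS1 g _)) => //; exact: leqnSn.
rewrite (@Hstair_toggle _ _ z (S z)) //.
- apply: eq_Hstair => // i _; left; rewrite /upd; case: eqP => [->|iz] //.
  by rewrite t2 /upd; case: eqP.
- by rewrite t2 /upd ifF ?tz //; lia.
- by rewrite t2 /upd eqxx.
- exact: toggled_ceiling mS2 S2x.
- by rewrite /g' /shift; lia.
Qed.

Lemma Hstair_last_neg S g d :
    (forall i, i < l -> i < S i)%N -> (0 < l)%N -> g l.-1 < 0 ->
  Hstair S g d = 0.
Proof.
move=> iS l0 gl; rewrite HstairE; have ll : (l.-1 < l)%N by lia.
apply: (@catalan_last_neg _ _ _ (Ordinal ll)) => //; last by rewrite mxE.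
apply/subsetP => -[i j]; rewrite !inE /=; have := iS i (ltn_ord i); lia.
Qed.
End Staircase.

(** * Mirrored chains *)

Section AlmostStrict.
Variables (l z : nat) (S : nat -> nat) (g : nat -> int).
Hypotheses (zl : (z.+1 < l)%N) (Sz : S z = S z.+1) (zSz : (z.+1 < S z)%N).
Hypothesis S_lt : forall i j, (i < j < l)%N -> i != z -> (S i < S j)%N.
Hypothesis S_flat : forall a, (a < z)%N -> S a.+1 = (S a).+1 -> g a = g a.+1.

Lemma le_start i j : (i <= j < l)%N -> (S i <= S j)%N.
Proof.
move=> /andP[ij jl]; case: (i =P j) => [->//|/eqP nij].
case: (i =P z) => [iz|/eqP iz]; last by apply/ltnW/S_lt => //; lia.
case: (j =P z.+1) => [->|/eqP jz]; first by rewrite iz Sz.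
by rewrite iz Sz ltnW // S_lt //; lia.
Qed.

(** Starts increase strictly before [z], so no row fits between one starting at [b] and one starting
    at [b.+1]; rows from [z] on start too late. *)
Lemma start_succ a b r : (a < z)%N -> (b <= z)%N -> S a = b -> (r < l)%N -> S r = b.+1 ->
  r = a.+1 /\ (a.+1 < z)%N.
Proof.
move=> az bz Sa rl Sr.
have rz : (r < z)%N.
  by rewrite ltnNge; apply/negP => zr; have := @le_start z r; lia.
have ar : (a < r)%N.
  by rewrite ltnNge; apply/negP => ra; have := @le_start r a; lia.
case: (r =P a.+1) => [->|/eqP nra]; first by split=> //; lia.
by have := @S_lt a a.+1; have := @S_lt a.+1 r; lia.
Qed.

Lemma mirrored_start x xs : mirrored l S g x xs -> last x xs = z -> (x.+1 < S x)%N.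
Proof.
elim: xs x => [|b xs IH] x /=; first by move=> _ ->.
by move=> [[-> _ xb _ _] _].
Qed.

Lemma mirrored_cons x xs : mirrored l S g (S x) xs -> last (S x) xs = z ->
  (x < S x)%N -> S x.+1 = (S x).+1 -> mirrored l S g x (S x :: xs).
Proof.
move=> m lz xS Sx1; have [bz _] := mirrored_last m; rewrite lz in bz.
(* If [S x = x.+1], then row [S x] would start in column [(S x).+1], contradicting [mirrored_start]
   for the tail. *)
have xl : (x.+1 < S x)%N.
  have h := mirrored_start m lz; rewrite ltn_neqAle xS andbT; apply/eqP => e.
  by have := congr1 S e; lia.
split=> //; split=> //; first by apply: S_flat => //; lia.
by move=> r rl Sr; apply: (fun h1 h2 => proj1 (@start_succ x _ r h1 h2 erefl rl Sr)); lia.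
Qed.

Hypothesis S_gt : forall i, (i < S i)%N.

Lemma mirroredI x xs : path (fun a b => S a == b) x xs ->
    path (fun a b => S a.+1 == b.+1) x xs -> last x xs = z -> mirrored l S g x xs.
Proof.
elim: xs x => [|b xs IH] x /=; first by move=> _ _ ->.
move=> /andP[/eqP<- p1] /andP[/eqP Sx p2] lz.
by apply: mirrored_cons => //; exact: IH.
Qed.

(* A chain which fails to be mirrored has a mirrored end segment whose top
   column is level with the next one. *)
Lemma mirrored_or_zero x xs d : path (fun a b => S a == b) x xs ->
    last x xs = z -> g z.+1 = g z + 1 ->
  mirrored l S g x xs \/ Hstair l S g d = 0.
Proof.
move=> + + gz; elim: xs x => [|b xs IH] x /=; first by move=> _ ->; left.
move=> /andP[/eqP<- p1] lz; case: (IH _ p1 lz) => [m|]; last by right.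
case: (S x.+1 =P (S x).+1) => [Sx1|Sx1]; first by left; apply: mirrored_cons.
right; apply: (Hstair_mirrored_eq0 _ m); rewrite ?lz // => r rl Sr.
have [bz _] := mirrored_last m; rewrite lz in bz; have xS := S_gt x.
by case: Sx1; rewrite -(proj1 (@start_succ x _ r _ _ erefl rl Sr)) //; lia.
Qed.
End AlmostStrict.

(** * Iteration along the shifted chains *)

(** The first column of row [i] in the ideal of [g]; the argument of [absz] is positive as soon as
    [g i <= k]. *)
Definition rowstart (k : nat) (g : nat -> int) i : nat := absz (k%:Z - g i + i.+1%:Z).

Lemma mirrored_path l S g x xs : mirrored l S g x xs ->
  path (fun a b => S a.+1 == b.+1) x xs.
Proof. by elim: xs x => [|b xs IH] x //= [[_ -> _ _ _] /IH ->]; rewrite eqxx. Qed.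

Lemma path_bounds x xs a : path ltn x xs -> a \in x :: xs -> (x <= a <= last x xs)%N.
Proof.
elim: xs x a => [|b xs IH] x a /=; first by rewrite inE => _ /eqP->; rewrite leqnn.
move=> /andP[xb p]; have h := IH b b p (mem_head _ _).
by rewrite inE => /orP[/eqP->|/(IH _ _ p)]; lia.
Qed.

Lemma path_succ (e : rel nat) x xs a : path e x xs -> a \in x :: xs -> a != last x xs ->
  exists2 b, b \in xs & e a b.
Proof.
elim: xs x => [|b xs IH] x /=; first by rewrite inE => _ /eqP->; rewrite eqxx.
move=> /andP[exb p]; rewrite inE => /orP[/eqP-> _|ab al].
  by exists b; rewrite ?mem_head.
by have [c cb ec] := IH b p ab al; exists c; rewrite // inE cb orbT.
Qed.

Section Partition.
Variables (l k z : nat) (L : nat -> int).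
Hypothesis L_lek : forall i, L i <= k%:Z.
Hypothesis L_decr : forall i j, (i <= j)%N -> L j <= L i.

Let mu0 : nat -> int := lower L z.
Let S0 : nat -> nat := rowstart k mu0.

(* The weight reached from mu = L - e_z after s steps; the row y is y + 1 in the paper. *)
Definition moved y s : nat -> int :=
  fun j => L j + ((y <= j < y + s)%N : nat)%:Z - ((z <= j <= z + s)%N : nat)%:Z.

Lemma moved0 y : moved y 0 =1 mu0.
Proof. by move=> j; rewrite /moved /mu0 /lower; lia. Qed.

(** * Row starts of the weight reached after [s] steps *)

Section Moved.
Variables (y s : nat).
Hypothesis ys : s = 0 \/ [/\ (y + s <= z)%N, L y < k%:Z & forall i, (i < y)%N -> L y < L i].
Let mu := moved y s.
Let S := rowstart k mu.

Lemma moved_lek i : mu i <= k%:Z.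
Proof.
have := L_lek i; have := @L_decr y i.
by rewrite /mu /moved; case: ys => [->|[h1 h2 h3]]; lia.
Qed.

Lemma rowstart_moved i : (S i)%:Z = k%:Z - mu i + i.+1%:Z.
Proof. by rewrite /S /rowstart; have := moved_lek i; lia. Qed.

Lemma rowstart_gt i : (i < S i)%N.
Proof. by have := moved_lek i; have := rowstart_moved i; lia. Qed.

(** The only possible ascent of the moved weight is from the block ending at [z + s] to what follows
    it, and it is by one. From a row other than [z + s] it spans at least two rows, too long to
    level the starts. *)
Lemma rowstart_lt i j : (i < j)%N -> i != (z + s)%N -> (S i < S j)%N.
Proof.
move=> ij iz; suff: mu j + i%:Z < mu i + j%:Z.
  by have := rowstart_moved i; have := rowstart_moved j; lia.
have h := L_decr (ltnW ij); move: iz; rewrite /mu /moved.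
case: ys => [->|[h1 _ h2]]; first by lia.
case: (leqP y j) => yj; last by lia.
have hy := L_decr yj; case: (ltnP i y) => [/h2|]; lia.
Qed.

Lemma rowstart_flat a : S a.+1 = (S a).+1 -> mu a = mu a.+1.
Proof. by have := rowstart_moved a; have := rowstart_moved a.+1; lia. Qed.

Lemma rowstart_wall : L (z + s)%N = L (z + s).+1 -> S (z + s) = S (z + s).+1.
Proof.
have := rowstart_moved (z + s); have := rowstart_moved (z + s).+1.
by rewrite /mu /moved; case: ys => [->|[h1 _ _]]; lia.
Qed.

Lemma rowstart_wall_gt : ((z + s).+1 < S (z + s))%N.
Proof.
have := rowstart_moved (z + s); have := L_lek (z + s).
by rewrite /mu /moved; case: ys => [->|[h1 _ _]]; lia.
Qed.

Lemma moved_ascent : L (z + s)%N = L (z + s).+1 -> mu (z + s).+1 = mu (z + s)%N + 1.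
Proof. by rewrite /mu /moved; case: ys => [->|[h1 _ _]]; lia. Qed.
End Moved.

(** * The reversed bounce path and its shifts *)

Section Chain.
Variables (x : nat) (xs : seq nat).
Hypothesis chain : path (fun a b => S0 a == b) x xs.
Hypothesis chain_last : last x xs = z.

Let S0E i : (S0 i)%:Z = k%:Z - mu0 i + i.+1%:Z.
Proof.
have := rowstart_moved (y := 0) (or_introl erefl) i.
by rewrite /S0 /rowstart moved0.
Qed.

Let S0_gt i : (i < S0 i)%N.
Proof.
have := S0E i; have := L_lek i; rewrite /mu0 /lower; lia.
Qed.

Let S0_lt i j : (i < j)%N -> i != z -> (S0 i < S0 j)%N.
Proof.
have := @rowstart_lt 0 0 (or_introl erefl) i j.
by rewrite /S0 /rowstart !moved0 addn0.
Qed.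

Let chain_ltn : path ltn x xs.
Proof. by apply: sub_path chain => a b /eqP <-; exact: S0_gt. Qed.

Let chain_bounds a : a \in x :: xs -> (x <= a <= z)%N.
Proof. by move=> /(path_bounds chain_ltn); rewrite chain_last. Qed.

Definition chain_const h :=
  forall a j, a \in x :: xs -> a != z -> (j <= h)%N -> mu0 (a + j)%N = mu0 a.

Variable h : nat.
Hypothesis hconst : chain_const h.
Hypothesis hL : forall j, (j <= h)%N -> L (z + j)%N = L z.

(* The gap of a row x_i is k + 1 - mu_(x_i): two consecutive intervals that meet
   have equal gaps, and the last interval cannot reach z. *)
Lemma chain_gap : path (fun a b => a + h < b)%N x xs.
Proof.
suff gap ys a : path (fun a b => S0 a == b) a ys -> last a ys = z ->
    {subset a :: ys <= x :: xs} -> path (fun a b => a + h < b)%N a ys by exact: gap.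
elim: ys a => [|b ys IH] a //= /andP[/eqP Sa p] lz sub.
have sub' : {subset b :: ys <= x :: xs} by move=> i ii; apply: sub; rewrite inE ii orbT.
have IHb := IH _ p lz sub'; rewrite IHb andbT ltnNge; apply/negP => bah.
have ab : (a < b)%N by rewrite -Sa.
have /andP[xb bz] := chain_bounds (sub' b (mem_head _ _)).
have := @hconst a (b - a)%N (sub a (mem_head _ _)); rewrite subnKC ?(ltnW ab) // => ba.
have {}ba : mu0 b = mu0 a by apply: ba; lia.
case: ys p lz IHb {IH sub sub'} => [|c ys] /= p lz IHb.
  by have := L_decr (ltnW ab); move: ba; rewrite /mu0 /lower; lia.
move: p IHb => /andP[/eqP Sb _] /andP[bc _].
by have := S0E a; have := S0E b; lia.
Qed.

Variable y : nat.
Hypothesis yconst : forall j, (j < h)%N -> mu0 (y + j)%N = mu0 y.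
Hypothesis yx : (y < x)%N.
Hypothesis Sy : S0 y = x.+1.
Hypothesis Sx : forall r, S0 r <> x.

Let xz : (x <= z)%N.
Proof. by have /andP[] := chain_bounds (mem_head x xs). Qed.

Let Ly_lt : L y < k%:Z.
Proof. by have := S0E y; rewrite /mu0 /lower; lia. Qed.

(** If [y.-1] had the same entry as [y], row [y.-1] would start in column [x], where no row
    starts. *)
Let Ly_top i : (i < y)%N -> L y < L i.
Proof.
move=> iy; have yz : y.-1 != z by have := xz; lia.
have := S0_lt _ yz => /(_ y); have := @Sx y.-1; have := S0E y; have := S0E y.-1.
have := @L_decr i y.-1; rewrite /mu0 /lower; have := xz; lia.
Qed.

(** As in [chain_gap]: if the interval from [y] reached past [x], rows [y] and [x] would have equal
    gaps, and the interval at [x] would meet its successor. *)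
Let y_gap : (y + h <= x)%N.
Proof.
case: (leqP (y + h) x) => // xyh.
have := @yconst (x - y)%N; rewrite subnKC ?(ltnW yx) // => e.
have {}e : mu0 x = mu0 y by apply: e; lia.
have := chain_gap; case: (xs) chain chain_last => [|b ys] /= c cl.
  by have := L_decr (ltnW yx); move: e; rewrite /mu0 /lower; lia.
by move: c => /andP[/eqP Sxb _] /andP[xb _]; have := S0E x; have := S0E y; lia.
Qed.

Lemma admissible s : (s <= h)%N ->
  s = 0 \/ [/\ (y + s <= z)%N, L y < k%:Z & forall i, (i < y)%N -> L y < L i].
Proof. by move=> sh; right; split=> //; have := y_gap; lia. Qed.

Let S s := rowstart k (moved y s).

Let SE s i : (s <= h)%N -> (S s i)%:Z = k%:Z - moved y s i + i.+1%:Z.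
Proof. by move=> sh; apply: rowstart_moved; exact: admissible. Qed.

Let moved_chain a s : (x <= a)%N -> (a + s < z)%N -> (s <= h)%N ->
  moved y s (a + s) = mu0 (a + s).
Proof. by move=> xa az sh; have := y_gap; rewrite /moved /mu0 /lower; lia. Qed.

Lemma chain_shift s : (s <= h)%N ->
  path (fun a b => S s a == b) (x + s)%N (map (addn^~ s) xs).
Proof.
move=> sh; rewrite -[(x + s)%N]/(addn^~ s x) path_map.
have := chain; have := chain_gap => p1 p2.
have : path [rel a b | (a + h < b)%N && (S0 a == b)] x xs by rewrite path_relI p1 p2.
apply: (fun H => sub_in_path (P := [in x :: xs]) H (allss _)) => a b /= aP bP /andP[ab /eqP Sa].
have /andP[xa _] := chain_bounds aP; have /andP[_ bz] := chain_bounds bP.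
have m : moved y s (a + s) = mu0 a.
  by rewrite moved_chain //; [apply: hconst|]; rewrite ?aP //; lia.
by have := SE (a + s) sh; have := S0E a; rewrite m; lia.
Qed.

(** As [s < h], constancy still covers the offset [s.+1], so row [a + s.+1] starts [s.+1] columns
    after row [a]. *)
Lemma chain_shift_succ s : (s < h)%N ->
  path (fun a b => S s a.+1 == b.+1) (x + s)%N (map (addn^~ s) xs).
Proof.
move=> sh; rewrite -[(x + s)%N]/(addn^~ s x) path_map.
have := chain; have := chain_gap => p1 p2.
have : path [rel a b | (a + h < b)%N && (S0 a == b)] x xs by rewrite path_relI p1 p2.
apply: (fun H => sub_in_path (P := [in x :: xs]) H (allss _)) => a b /= aP bP /andP[ab /eqP Sa].
have /andP[xa _] := chain_bounds aP; have /andP[_ bz] := chain_bounds bP.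
have m : moved y s (a + s).+1 = mu0 a.
  transitivity (mu0 (a + s.+1)%N); last by apply: hconst => //; lia.
  by have := y_gap; rewrite addnS /moved /mu0 /lower; lia.
by have := @SE s (a + s).+1; have := S0E a; rewrite m; lia.
Qed.

Lemma last_shift s : last (x + s)%N (map (addn^~ s) xs) = (z + s)%N.
Proof. by rewrite -[(x + s)%N]/(addn^~ s x) last_map chain_last. Qed.

Lemma Hstair_moved s d : (z + h < l)%N -> (s < h)%N ->
  Hstair l (S s) (moved y s) d = tmul (size xs).+1 (Hstair l (S s.+1) (moved y s.+1)) d.
Proof.
move=> zl sh; have sh' := ltnW sh; have adm := admissible sh'.
have Lz : L (z + s)%N = L (z + s).+1 by rewrite -addnS !hL.
have wall := rowstart_wall adm Lz.
have wgt := rowstart_wall_gt adm.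
have zsl : ((z + s).+1 < l)%N by lia.
have lt i j : (i < j < l)%N -> i != (z + s)%N -> (S s i < S s j)%N.
  by move=> /andP[ij _]; exact: rowstart_lt.
have m : mirrored l (S s) (moved y s) (x + s)%N (map (addn^~ s) xs).
  apply: (mirroredI zsl wall wgt lt).
  - by move=> a _; exact: rowstart_flat.
  - exact: rowstart_gt.
  - exact: chain_shift.
  - exact: chain_shift_succ.
  - exact: last_shift.
have my : moved y s (y + s) = mu0 y.
  rewrite -(yconst sh); by have := y_gap; rewrite /moved /mu0 /lower; lia.
have Sys : S s (y + s) = (x + s).+1.
  by have := SE (y + s) sh'; have := S0E y; rewrite my; lia.
have ylt : (y + s < z + s)%N by lia.
rewrite (@Hstair_straighten l (S s) (moved y s) (x + s)%N (map (addn^~ s) xs) (y + s)%N) //;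
  rewrite ?last_shift //.
(* The two updates of the staircase are exactly the row changes caused by raising entry [y + s] and
   lowering entry [(z + s).+1]. *)
- rewrite size_map; apply: eq_tmul => {}d; apply: eq_Hstair => i _; last first.
    by have := y_gap; rewrite /shift /moved; lia.
  left; rewrite /upd; have := @SE s.+1 i sh; have := @SE s i sh'.
  have := SE (z + s).+1 sh'; have := SE (z + s) sh'.
  have := y_gap; rewrite /moved; case: eqP => [->|]; last case: eqP => [->|]; lia.
- by rewrite ltn_add2r.
- move=> r rl Sr; case: (ltngtP r (y + s)) => // c.
    by have := @rowstart_lt _ _ adm _ _ c; rewrite -/(S s) Sr Sys; lia.
  by have := @rowstart_lt _ _ adm _ _ c; rewrite -/(S s) Sr Sys; lia.
- exact: moved_ascent.
Qed.

Lemma Hstair_moved_iter s d : (z + h < l)%N -> (s <= h)%N ->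
  Hstair l S0 mu0 d = tmul (s * (size xs).+1) (Hstair l (S s) (moved y s)) d.
Proof.
move=> zl; elim: s d => [|s IH] d sh.
  rewrite mul0n /tmul /= subn0; apply: eq_Hstair => i _; last by rewrite moved0.
  by left; rewrite /S /S0 /rowstart moved0.
rewrite IH 1?ltnW // mulSnr -tmulD; apply: eq_tmul => {}d.
exact: Hstair_moved.
Qed.

(** The ascent at [z + h] persists. Either the shifted chain fails to be mirrored, and
    [mirrored_or_zero] applies, or it extends the constancy to [h.+1]; then the block at [y] must
    end, and no row starts in column [(x + h).+1]. *)
Lemma Hstair_moved_eq0 d : (0 < h)%N -> ((z + h).+1 < l)%N -> L (z + h).+1 = L z ->
    ~ (chain_const h.+1 /\ mu0 (y + h)%N = mu0 y) ->
  Hstair l (S h) (moved y h) d = 0.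
Proof.
move=> h0 zl Lzh nmax; have adm := admissible (leqnn h).
have Lz : L (z + h)%N = L (z + h).+1 by rewrite Lzh hL.
have wall := rowstart_wall adm Lz.
have wgt := rowstart_wall_gt adm.
have lt i j : (i < j < l)%N -> i != (z + h)%N -> (S h i < S h j)%N.
  by move=> /andP[ij _]; exact: rowstart_lt.
have fl a : (a < z + h)%N -> S h a.+1 = (S h a).+1 -> moved y h a = moved y h a.+1.
  by move=> _; exact: rowstart_flat.
have asc := moved_ascent adm Lz.
have [m|//] := mirrored_or_zero zl wall wgt lt fl (rowstart_gt adm) d
  (chain_shift (leqnn h)) (last_shift h) asc.
have cc : chain_const h.+1.
  move=> a j aP az jh; case: (ltnP h j) => [hj|]; last exact: hconst.
  have -> : j = h.+1 by lia.
  have := mirrored_path m; rewrite -[(x + h)%N]/(addn^~ h x) path_map => p1.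
  have p2 := chain_gap; have p3 := chain.
  have : path [rel a b | ((a + h < b)%N && (S0 a == b))
                      && (S h (a + h).+1 == (b + h).+1)] x xs.
    by rewrite (path_relI [rel a b | (a + h < b)%N && (S0 a == b)]) path_relI p2 p3.
  move=> /path_succ/(_ aP); rewrite chain_last => /(_ az)[b bP /andP[/andP[/= ab /eqP Sa] /eqP Sah]].
  have /andP[xa _] := chain_bounds aP.
  have /andP[_ bz] : (x <= b <= z)%N by apply: chain_bounds; rewrite inE bP orbT.
  have := S0E a; have := SE (a + h).+1 (leqnn h).
  by have := y_gap; rewrite Sa Sah addnS /moved /mu0 /lower; lia.
have yne : mu0 (y + h)%N <> mu0 y by move=> e; apply: nmax.
apply: (Hstair_mirrored_eq0 _ m); rewrite ?last_shift //.
move=> r rl; rewrite -[rowstart _ _ r]/(S h r) => Sr.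
have := y_gap => yg; have xz' := xz.
(* Rows before [y + h] have a raised neighbour [(y + h).-1] bounding their start; at [y + h] the
   weight drops, which skips column [(x + h).+1]. *)
suff: (S h r <= x + h)%N || (x + h.+1 < S h r)%N by rewrite Sr; lia.
case: (ltnP r (y + h)) => ry.
  have : (S h r <= S h (y + h).-1)%N.
    by apply: (le_start zl wall wgt lt); lia.
  have e : mu0 (y + h).-1 = mu0 y.
    by rewrite -(@yconst h.-1) ?prednK //; congr mu0; lia.
  have := SE (y + h).-1 (leqnn h); move: e; have := S0E y.
  rewrite /moved /mu0 /lower; lia.
have : (S h (y + h) <= S h r)%N by apply: (le_start zl wall wgt lt); lia.
have := SE (y + h) (leqnn h); have := S0E y; have := @L_decr y (y + h).
move: yne; rewrite /moved /mu0 /lower; lia.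
Qed.
End Chain.
End Partition.

(** * Bounce paths *)

Lemma Delta_rowfun l k g : (forall i, g i <= k%:Z) ->
  Delta k (rowfun l g) = staircase l (rowstart k g).
Proof.
move=> gk; apply/setP => -[i j].
by rewrite !inE !mxE /rowstart /=; have := gk i; lia.
Qed.

Lemma kschur_rowfun l k g : (forall i, g i <= k%:Z) ->
  kschur k (rowfun l g) = Hstair l (rowstart k g) g.
Proof. by move=> gk; rewrite HstairE /kschur Delta_rowfun. Qed.

Lemma const_on_rowfun l (g : nat -> int) a b :
  reflect (forall i j, (a <= i < b)%N -> (a <= j < b)%N -> (i < l)%N -> (j < l)%N -> g i = g j)
          (const_on (rowfun l g) a b).
Proof.
apply: (iffP forallP) => [H i j ib jb il jl|H i].
  have /forallP/(_ (Ordinal jl))/implyP := H (Ordinal il).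
  by rewrite !mxE /= ib jb => /(_ isT)/eqP.
apply/forallP => j; apply/implyP => /andP[ib jb]; rewrite !mxE.
by apply/eqP/H.
Qed.

Lemma pmap_iter_decr l (f : 'I_l -> option 'I_l) n (x : 'I_l) :
    (forall a b, f a = Some b -> (b < a)%N) -> (x < n)%N ->
  exists p, [/\ pmap (fun m => iter m (obind f) (Some x)) (iota 0 n) = x :: p,
    path (fun a b => f a == Some b) x p & f (last x p) = None].
Proof.
move=> fd; elim: n x => // n IH x xn.
have iterN m : iter m (obind f) None = None by elim: m => //= m ->.
have -> : iota 0 n.+1 = 0 :: [seq i.+1 | i <- iota 0 n].
  by congr (_ :: _); exact: (iotaDl 1 0 n).
have E o : pmap (fun m => iter m (obind f) (Some x)) [seq i.+1 | i <- o] =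
  pmap (fun m => iter m (obind f) (f x)) o.
  by elim: o => //= i o ->; rewrite -iterS iterSr.
rewrite /= E; case fx: (f x) => [b|] /=.
  have [p [p1 p2 p3]] := IH b (leq_trans (fd _ _ fx) xn).
  by exists (b :: p); rewrite p1 /= fx eqxx.
exists [::]; split=> //=; congr (_ :: _).
by elim: (iota 0 n) => //= i o ->; rewrite iterN.
Qed.

Section Staircase.
Variables (l z : nat) (S : nat -> nat).
Hypotheses (zl : (z.+1 < l)%N) (Sz : S z = S z.+1) (zSz : (z.+1 < S z)%N).
Hypothesis S_lt : forall i j, (i < j < l)%N -> i != z -> (S i < S j)%N.
Hypothesis S_gt : forall i, (i < S i)%N.

Let Psi := staircase l S.

(** The first root of a row is removable unless the next row starts in the same column. That happens
    only at [z], whose start lies beyond the columns considered. *)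
Lemma removable_staircase (i x : 'I_l) : (x <= z.+1)%N -> removable Psi (i, x) = (S i == x).
Proof.
move=> xz; apply/idP/eqP => [|Si].
  rewrite /removable inE /= => /andP[Six /andP[_ /forallP H]]; apply/eqP.
  rewrite eqn_leq Six leqNgt /=; apply/negP => Sx.
  (* If row [i] started before [x], the remaining root [(i, x.-1)] would force [(i, x)] back in. *)
  have x1 : (x.-1 < l)%N by have := ltn_ord x; lia.
  have := H (i, Ordinal x1); rewrite !inE xpair_eqE -!val_eqE /= => /implyP.
  rewrite eqxx /=; have -> : (x.-1 == x) = false by lia.
  have -> : (S i <= x.-1)%N by lia.
  move=> /(_ isT)/forallP/(_ (i, x)); rewrite !inE eqxx /= /root_le /= leqnn leq_pred /=.
  by have := S_gt i; lia.
rewrite /removable inE /= Si leqnn /=; apply/andP; split.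
  apply/subsetP => -[a b]; rewrite !inE /= => /andP[_]; have := S_gt a; lia.
apply/forallP => -[a b]; apply/implyP; rewrite !inE xpair_eqE -!val_eqE /= => /andP[ne Sab].
apply/forallP => -[c d]; apply/implyP; rewrite !inE /root_le /= => cd; apply/implyP.
move=> /andP[ca bd].
have Sca : (S c <= S a)%N by apply: (le_start zl Sz zSz S_lt); rewrite ca /=.
rewrite xpair_eqE -!val_eqE /=; apply/andP; split; last lia.
apply/negP => /andP[/eqP ci /eqP dx]; move: ne; rewrite negb_and.
have iz : i != z :> nat by apply/eqP => iz; move: Si zSz; rewrite iz; lia.
case: (ltngtP a i) => [|ia|ai]; first by lia.
  by have := ltn_ord a; have := @S_lt i a; rewrite ia iz => /(_ _ isT) + al; rewrite al; lia.
by have := congr1 S ai; lia.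
Qed.

Lemma up_Some (i x : 'I_l) : (x <= z.+1)%N -> up Psi x = Some i -> S i = x.
Proof.
by rewrite /up => xz; case: pickP => // j; rewrite removable_staircase // => /eqP Sj [<-].
Qed.

Lemma up_None (x : 'I_l) : (x <= z.+1)%N -> up Psi x = None -> forall r, S r <> x.
Proof.
rewrite /up => xz; case: pickP => // H _ r Sr.
have rl : (r < l)%N by have := S_gt r; have := ltn_ord x; lia.
by have := H (Ordinal rl); rewrite removable_staircase //= Sr eqxx.
Qed.

Lemma up_lt (a b : 'I_l) : up Psi a = Some b -> (b < a)%N.
Proof.
rewrite /up; case: pickP => // j; rewrite /removable inE /= => /andP[Sj _] [<-].
exact: leq_trans (S_gt j) Sj.
Qed.

(** By [start_succ], the path from [w1] can only run parallel to that from [w], one index higher; it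
    stops early exactly when the mirror condition fails. *)
Lemma up_iter_mirror (w w1 : 'I_l) p : (w <= z)%N -> w1 = w.+1 :> nat ->
    path (fun a b => up Psi a == Some b) w p ->
  if up_iter Psi (size p) w1 is Some u then
    u = (last w p).+1 :> nat /\ path (fun b a : 'I_l => S a.+1 == b.+1) w p
  else ~~ path (fun b a : 'I_l => S a.+1 == b.+1) w p.
Proof.
elim: p w w1 => [|b p IH] w w1 wz w1E //= /andP[/eqP wb pb].
have Sb : S b = w by apply: up_Some wb; lia.
have bw : (b < w)%N by rewrite -Sb.
have bz : (b < z)%N by lia.
have w1z : (w1 <= z.+1)%N by lia.
rewrite /up_iter -iterS iterSr /=.
case w1r: (up Psi w1) => [r|].
  have Sr : S r = w.+1 by rewrite -w1E; exact: up_Some w1r.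
  have [rb _] := start_succ zl Sz zSz S_lt bz wz Sb (ltn_ord r) Sr.
  by have := IH b r (ltnW bz) rb pb; rewrite -rb Sr eqxx /=.
have -> : iter (size p) (obind (up Psi)) None = None by elim: (size p) => //= m ->.
rewrite negb_and; apply/orP; left; apply/eqP => Sb1.
by apply: (up_None w1z w1r (r := b.+1)); rewrite Sb1.
Qed.
End Staircase.

(** * Covers *)

(* Padding by 0 keeps the sequence of parts of a partition decreasing on all of nat. *)
Definition entry l (v : 'rV[int]_l) (i : nat) : int :=
  if insub i is Some j then v 0 j else 0.

Lemma entryE l (v : 'rV[int]_l) (i : 'I_l) : entry v i = v 0 i.
Proof. by rewrite /entry valK. Qed.

Lemma Par_entry k l (v : 'rV[int]_l) : Par k v ->
  [/\ forall i, 0 <= entry v i, forall i, entry v i <= k%:Z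
    & forall i j, (i <= j)%N -> entry v j <= entry v i].
Proof.
move=> /andP[/forallP r /forallP d].
have ge0 i : 0 <= entry v i.
  by rewrite /entry; case: insubP => // j _ _; have /andP[] := r j.
split=> // [i|i j ij].
  by rewrite /entry; case: insubP => // j _ _; have /andP[] := r j.
case: (ltnP j l) => jl; last first.
  by rewrite {1}/entry insubF //; lia.
have il : (i < l)%N by lia.
rewrite -[i]/(val (Ordinal il)) -[j]/(val (Ordinal jl)) !entryE.
by have /forallP/(_ (Ordinal jl))/implyP := d (Ordinal il); apply.
Qed.

(** The raised entries begin at the top of a block, and the lowered ones form a positive constant
    block followed by a descent. *)
Lemma Par_moved k l z (L : nat -> int) y s :
    (forall i, 0 <= L i) -> (forall i, L i <= k%:Z) ->
    (forall i j, (i <= j)%N -> L j <= L i) ->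
    s = 0 \/ [/\ (y + s <= z)%N, L y < k%:Z & forall i, (i < y)%N -> L y < L i] ->
    (forall j, (j <= s)%N -> L (z + j)%N = L z) -> (z + s < l)%N ->
    0 < L z -> ((z + s).+1 < l)%N ==> (L (z + s).+1 < L z) ->
  Par k (rowfun l (moved z L y s)).
Proof.
move=> L0 Lk Ld ys Lc zsl Lz Ltop; apply/andP; split.
  apply/forallP => i; rewrite mxE moved_lek // andbT.
  have Li := L0 i; case: (boolP (z <= i <= z + s)%N) => [iz|]; last by rewrite /moved; lia.
  have := Lc (i - z)%N; rewrite subnKC; last by lia.
  by move=> /(_ ltac:(lia)); rewrite /moved; lia.
apply/forallP => i; apply/forallP => j; apply/implyP => ij; rewrite !mxE.
have jl := ltn_ord j; have Lij := Ld _ _ ij.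
case: (boolP ((z <= i <= z + s)%N && (z + s < j)%N)) => [/andP[iz zj]|nz].
  have := Lc (i - z)%N; rewrite subnKC; last by lia.
  move=> /(_ ltac:(lia)) Li; have Lj := Ld _ _ zj.
  have := implyP Ltop ltac:(lia).
  move: ys; rewrite /moved => -[->|[ys1 _ _]]; lia.
move: ys nz; rewrite /moved => -[->|[ys1 _ ys3]] nz; first by lia.
case: (ltnP i y) => iy; last by lia.
case: (leqP y j) => yj; last by lia.
by have := ys3 _ iy; have := Ld _ _ yj; lia.
Qed.

Section Cover.
Variables (k l : nat) (lam : 'rV[int]_l) (z : 'I_l).
Hypothesis hlam : Par k lam.
Let L := entry lam.
Let mu0 := lower L z.
Let S0 := rowstart k mu0.

Let L_ge0 i : 0 <= L i. Proof. by have [] := Par_entry hlam. Qed.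
Let L_lek i : L i <= k%:Z. Proof. by have [] := Par_entry hlam. Qed.
Let L_decr i j : (i <= j)%N -> L j <= L i.
Proof. by have [_ _] := Par_entry hlam; apply. Qed.

Let mu0_lek i : mu0 i <= k%:Z.
Proof. by have := L_lek i; rewrite /mu0 /lower; lia. Qed.

Lemma cvr_mu_rowfun : cvr_mu lam z = rowfun l mu0.
Proof. by apply/rowP => i; rewrite !mxE eqxx /mu0 /lower /L entryE -val_eqE /=; lia. Qed.

Lemma cvr_ideal_staircase : cvr_ideal k lam z = staircase l S0.
Proof. by rewrite /cvr_ideal cvr_mu_rowfun Delta_rowfun. Qed.

Lemma kschur_cvr_mu : kschur k (cvr_mu lam z) = Hstair l S0 mu0.
Proof. by rewrite cvr_mu_rowfun kschur_rowfun. Qed.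

Lemma cvr_mu_Par : 0 < L z -> (z.+1 < l)%N ==> (L z.+1 < L z) -> Par k (cvr_mu lam z).
Proof.
move=> Lz Lz1; have := @Par_moved k l z L 0 0 L_ge0 L_lek L_decr (or_introl erefl).
rewrite addn0 => /(_ _ (ltn_ord z) Lz Lz1) P.
rewrite cvr_mu_rowfun; have -> : rowfun l mu0 = rowfun l (moved z L 0 0).
  by apply/rowP => i; rewrite !mxE moved0.
by apply: P => j; rewrite leqn0 => /eqP->; rewrite addn0.
Qed.

(** * Covers when the entries at [z] and [z + 1] agree *)

Section Flat.
Hypotheses (zl : (z.+1 < l)%N) (Lz : L z = L z.+1).

(** The weight mu is the moved weight with [s = 0]; the value 0 for [y] is a placeholder. *)
Let ys0 : 0 = 0 :> nat \/ [/\ (0 + 0 <= z)%N, L 0 < k%:Z & forall i, (i < 0)%N -> L 0 < L i].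
Proof. by left. Qed.

Let S0E : rowstart k (moved z L 0 0) =1 S0.
Proof. by move=> i; rewrite /S0 /rowstart moved0. Qed.

Let wall : S0 z = S0 z.+1.
Proof. by have := rowstart_wall L_lek L_decr ys0; rewrite !S0E addn0; apply. Qed.

Let wall_gt : (z.+1 < S0 z)%N.
Proof. by have := rowstart_wall_gt L_lek L_decr ys0; rewrite !S0E addn0. Qed.

Let S0_lt i j : (i < j < l)%N -> i != z :> nat -> (S0 i < S0 j)%N.
Proof.
by move=> /andP[ij _] iz; rewrite -!S0E (rowstart_lt L_lek L_decr) ?addn0.
Qed.

Let S0_flat a : S0 a.+1 = (S0 a).+1 -> mu0 a = mu0 a.+1.
Proof. by have := @rowstart_flat k z L L_lek L_decr _ _ ys0 a; rewrite !S0E !moved0. Qed.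

Let S0_gt i : (i < S0 i)%N.
Proof. by have := rowstart_gt L_lek L_decr ys0 i; rewrite S0E. Qed.

Let ascent : mu0 z.+1 = mu0 z + 1.
Proof. by rewrite /mu0 /lower; lia. Qed.

(** The bounce path is read backwards, from its end [x] to [z]. Only c - 1 steps from [z + 1] are
    compared with it; the last step, to [y1], goes beyond the chain. *)
Lemma uppath_chain : exists (x : 'I_l) (xs : seq nat) (p : seq 'I_l),
  [/\ uppath (cvr_ideal k lam z) z = z :: p,
      (x : nat) :: xs = rev (map val (z :: p)),
      path (fun a b => S0 a == b) x xs,
      forall r, S0 r <> x
    & forall z1 : 'I_l, z1 = z.+1 :> nat ->
      if up_iter (cvr_ideal k lam z) (size p) z1 is Some u
      then u = x.+1 :> nat /\ path (fun a b => S0 a.+1 == b.+1) x xs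
      else ~~ path (fun a b => S0 a.+1 == b.+1) x xs].
Proof.
rewrite cvr_ideal_staircase.
have upl a b : up (staircase l S0) a = Some b -> (b < a)%N by exact: (up_lt S0_gt).
have [p [p1 p2 p3]] := pmap_iter_decr upl (ltn_ord z).
have [pS xz] : path (fun a b : 'I_l => S0 b == a) z p /\ (last z p <= z)%N.
  suff H q (w : 'I_l) : (w <= z)%N ->
      path (fun a b => up (staircase l S0) a == Some b) w q ->
      path (fun a b : 'I_l => S0 b == a) w q /\ (last w q <= z)%N by exact: H.
  elim: q w => //= b q IH w wz /andP[/eqP wb pb].
  have bz : (b <= z)%N by have := upl _ _ wb; lia.
  have [IH1 IH2] := IH _ bz pb; split=> //; rewrite IH1 andbT.
  by apply/eqP/(up_Some zl wall wall_gt S0_lt S0_gt) => //; lia.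
exists (last z p), (rev (belast (z : nat) (map val p))), p; split=> //.
- by rewrite map_cons [in RHS]lastI rev_rcons last_map.
- rewrite -(last_map val) rev_path path_map.
  by apply: sub_path pS => a b.
- move=> r; apply: (up_None zl wall wall_gt S0_lt S0_gt) p3 r; lia.
- move=> z1 z1E; have := up_iter_mirror zl wall wall_gt S0_lt S0_gt (leqnn z) z1E p2.
  by rewrite -(last_map val) rev_path path_map.
Qed.

Variables (x : 'I_l) (xs : seq nat) (p : seq 'I_l).
Hypothesis uppathE : uppath (cvr_ideal k lam z) z = z :: p.
Hypothesis xsE : (x : nat) :: xs = rev (map val (z :: p)).
Hypothesis chain : path (fun a b => S0 a == b) x xs.
Hypothesis Sx : forall r, S0 r <> x.
Hypothesis mirror : forall z1 : 'I_l, z1 = z.+1 :> nat ->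
  if up_iter (cvr_ideal k lam z) (size p) z1 is Some u
  then u = x.+1 :> nat /\ path (fun a b => S0 a.+1 == b.+1) x xs
  else ~~ path (fun a b => S0 a.+1 == b.+1) x xs.
Variables (z1 : 'I_l).
Hypothesis z1E : z1 = z.+1 :> nat.

Let chain_last : last (x : nat) xs = z.
Proof. by rewrite -[LHS](last_cons 0%N) xsE map_cons rev_cons last_rcons. Qed.

Let cE : cvr_c k lam z = (size xs).+1.
Proof. by rewrite /cvr_c uppathE -[RHS]/(size ((x : nat) :: xs)) xsE size_rev size_map. Qed.

Let size_xs : size xs = size p.
Proof. by have := congr1 size xsE; rewrite size_rev size_map => -[]. Qed.

Let chain_le a : a \in (x : nat) :: xs -> (x <= a <= z)%N.
Proof.
have : path ltn x xs by apply: sub_path chain => b c /eqP <-; exact: S0_gt.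
by move=> p1 ax; have := path_bounds p1 ax; rewrite chain_last.
Qed.

Let xz : (x <= z)%N. Proof. by have /andP[] := chain_le (mem_head _ _). Qed.

(** If the chain is mirrored, the first c - 1 steps reach [x.+1], so the missing step means that no
    row starts there. *)
Lemma Hstair_up_None d : up_iter (cvr_ideal k lam z) (cvr_c k lam z) z1 = None ->
  Hstair l S0 mu0 d = 0.
Proof.
rewrite cE size_xs /up_iter iterS -/(up_iter _ _ _) => upn.
have [m|//] := mirrored_or_zero zl wall wall_gt S0_lt (fun a _ => @S0_flat a) S0_gt d
  chain chain_last ascent.
have := mirror z1E; rewrite (mirrored_path m).
case E: (up_iter _ _ _) upn => [u|] //= upu [ux _].
apply: (Hstair_mirrored_eq0 _ m); rewrite ?chain_last // => r rl.
rewrite -ux; move: upu; rewrite cvr_ideal_staircase.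
by move=> /(up_None zl wall wall_gt S0_lt S0_gt); apply; lia.
Qed.

Variable y1 : 'I_l.
Hypothesis up_y1 : up_iter (cvr_ideal k lam z) (cvr_c k lam z) z1 = Some y1.

Let mirror_y1 : S0 y1 = x.+1 /\ path (fun a b => S0 a.+1 == b.+1) x xs.
Proof.
have := up_y1; rewrite cE size_xs /up_iter iterS -/(up_iter _ _ _).
have := mirror z1E.
case: (up_iter _ _ _) => [u|] //= [ux pm]; rewrite cvr_ideal_staircase => upu.
by split=> //; rewrite -ux; apply: (up_Some zl wall wall_gt S0_lt S0_gt) upu; lia.
Qed.

Let y1x : (y1 < x)%N.
Proof.
have [Sy pm] := mirror_y1; have := S0_gt y1; rewrite Sy ltnS leq_eqVlt => /orP[/eqP yx|//].
have m := mirroredI zl wall wall_gt S0_lt (fun a _ => @S0_flat a) S0_gt chain pm chain_last.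
by have := mirrored_start wall_gt m chain_last; rewrite -yx Sy yx ltnn.
Qed.

Lemma cvr_h_okP h : cvr_h_ok k lam z y1 h <->
  [/\ (1 <= h)%N, (z + h < l)%N, forall j, (j <= h)%N -> L (z + j)%N = L z,
      chain_const z L x xs h & forall j, (j < h)%N -> mu0 (y1 + j)%N = mu0 y1].
Proof.
rewrite /cvr_h_ok cvr_mu_rowfun uppathE; split.
  move=> /and4P[/andP[h1 hl] /const_on_rowfun cz /allP cx /const_on_rowfun cy].
  have zhl : (z + h < l)%N by lia.
  split=> //.
  - case=> [|j] jh; first by rewrite addn0.
    have := cz (z + j.+1)%N z.+1; rewrite /mu0 /lower => /(_ _ _ _ _)/=.
    by rewrite Lz; move=> /(_ ltac:(lia) ltac:(lia) ltac:(lia) ltac:(lia)); lia.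
  - move=> a j ax az jh; have := chain_le ax.
    move: ax; rewrite xsE mem_rev => /mapP[w wp]; rewrite -[val w]/(nat_of_ord w) => aw wz.
    have wf : w \in [seq x <- z :: p | x != z] by rewrite mem_filter wp andbT -val_eqE /= -aw.
    by have /const_on_rowfun cw := cx _ wf; rewrite aw in wz az *; apply: cw; lia.
  - by move=> j jh; apply: cy; lia.
move=> [h1 zhl cz cx cy]; apply/and4P; split.
- lia.
- apply/const_on_rowfun => i j iz jz _ _.
  have := cz (i - z)%N; have := cz (j - z)%N; rewrite !subnKC; try lia.
  by move=> /(_ ltac:(lia)) + /(_ ltac:(lia)); rewrite /mu0 /lower; lia.
- apply/allP => w; rewrite mem_filter -val_eqE /= => /andP[wz wp].
  have wx : (w : nat) \in (x : nat) :: xs by rewrite xsE mem_rev; apply: map_f.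
  apply/const_on_rowfun => i j iw jw _ _.
  have := cx w (i - w)%N wx wz; have := cx w (j - w)%N wx wz; rewrite !subnKC; try lia.
  by move=> /(_ ltac:(lia)) e1 /(_ ltac:(lia)) e2; exact: etrans e2 (esym e1).
- apply/const_on_rowfun => i j iw jw _ _.
  have := cy (i - y1)%N; have := cy (j - y1)%N; rewrite !subnKC; try lia.
Qed.

Hypothesis cvr_y1E : cvr_y1 k lam z = Some y1.
Let h := cvr_h k lam z.

Let h_le i : cvr_h_ok k lam z y1 i -> (i <= h)%N.
Proof.
move=> ok; have il : (i < l)%N by have /cvr_h_okP[] := ok; lia.
by rewrite /h /cvr_h cvr_y1E (@leq_bigmax_cond _ _ (fun i : 'I_l => i : nat) (Ordinal il)).
Qed.

Let h_ok : cvr_h_ok k lam z y1 h.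
Proof.
(* The maximum is attained because 1 is admissible: consecutive starts along the mirrored chain
   force equal entries. *)
have l1 : (1 < l)%N by lia.
have ok1 : cvr_h_ok k lam z y1 (Ordinal l1).
  apply/cvr_h_okP; split=> //=; first by rewrite addn1.
  - by case=> [|[|]] //; rewrite ?addn0 ?addn1.
  - move=> a [|[|j]] // ax az _; rewrite ?addn0 // addn1; symmetry; apply: S0_flat.
    have [_ pm] := mirror_y1.
    have p2 : path [rel a b | (S0 a == b) && (S0 a.+1 == b.+1)] x xs by rewrite path_relI chain.
    have [|b _ /andP[/eqP-> /eqP->]] // := path_succ p2 ax.
    by rewrite chain_last.
  - by case=> //; rewrite addn0.
rewrite /h /cvr_h cvr_y1E.
have [|i ok ->] := @eq_bigmax_cond _ [pred i : 'I_l | cvr_h_ok k lam z y1 i] (fun i : 'I_l => i : nat).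
  by apply/card_gt0P; exists (Ordinal l1).
exact: ok.
Qed.

Lemma cvr_rowfun : cvr k lam z = rowfun l (moved z L y1 h).
Proof.
rewrite /cvr cvr_y1E -/h; apply/rowP => i; rewrite !mxE /moved /L entryE ltnS.
by rewrite !natz.
Qed.

Lemma kschur_cvr :
  kschur k (cvr_mu lam z) =1 tmul (h * cvr_c k lam z) (kschur k (cvr k lam z)) /\
  (~~ Par k (cvr k lam z) -> kschur k (cvr_mu lam z) =1 fun=> 0).
Proof.
have [h1 zhl cz cx cy] := (cvr_h_okP h).1 h_ok.
have [Sy _] := mirror_y1.
have adm := admissible L_lek L_decr chain chain_last cx cy y1x Sy Sx (leqnn h).
have key : kschur k (cvr_mu lam z) =1 tmul (h * cvr_c k lam z) (kschur k (cvr k lam z)).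
  rewrite cvr_rowfun !kschur_rowfun; last exact: (moved_lek L_lek L_decr adm).
  rewrite kschur_cvr_mu cE => d.
  exact: (Hstair_moved_iter L_lek L_decr chain chain_last cx cz cy y1x Sy Sx d zhl (leqnn h)).
split=> // nPar d; rewrite key; apply: tmul0 => {}d.
rewrite cvr_rowfun kschur_rowfun; last exact: (moved_lek L_lek L_decr adm).
have Pmoved : 0 < L z -> ((z + h).+1 < l)%N ==> (L (z + h).+1 < L z) -> False.
  move=> Lz0 Ltop; move/negP: nPar; apply; rewrite cvr_rowfun.
  exact: (Par_moved L_ge0 L_lek L_decr adm cz zhl Lz0 Ltop).
(* A non-partition has one of two defects: [z + h] is the last index and its entry is negative, or
   there is an ascent at [z + h]. *)
case: (boolP ((z + h).+1 < l)%N) => zhl1; last first.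
  apply: Hstair_last_neg; first by move=> i _; exact: (rowstart_gt L_lek L_decr adm).
    by lia.
  have Lz0 : L z = 0.
    case: (L z =P 0) => [//|Lz0]; case: Pmoved; last by rewrite (negbTE zhl1).
    by have := L_ge0 z; lia.
  have -> : l.-1 = (z + h)%N by lia.
  by have := cz h (leqnn h); rewrite /moved Lz0; lia.
case: (L (z + h).+1 =P L z) => e.
  apply: (Hstair_moved_eq0 L_lek L_decr chain chain_last cx cz cy y1x Sy Sx d h1 zhl1 e).
  move=> [cx1 cy1]; suff /h_le : cvr_h_ok k lam z y1 h.+1 by rewrite ltnn.
  apply/cvr_h_okP; split=> // [|j|j]; first by rewrite addnS.
    by rewrite leq_eqVlt => /orP[/eqP->|/cz//]; rewrite addnS.
  by rewrite ltnS leq_eqVlt => /orP[/eqP->|/cy//].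
have Lt : L (z + h).+1 < L z.
  by have := @L_decr z (z + h).+1; have := L_ge0 (z + h).+1; lia.
by case: Pmoved; [have := L_ge0 (z + h).+1; lia|rewrite Lt implybT].
Qed.
End Flat.
End Cover.

Theorem theorem7p12 (k l : nat) (hk : (1 <= k)%N) (hl : (1 <= l)%N)
    (lam : 'rV[int]_l) (hlam : Par k lam) (z : 'I_l) :
  kschur k (cvr_mu lam z)
    =1 tmul (cvr_h k lam z * cvr_c k lam z)%N (kschur k (cvr k lam z))
  /\ (~~ Par k (cvr k lam z) ->
      kschur k (cvr_mu lam z) =1 (fun _ => 0%R)).
Proof.
(* Without [y1] the cover is mu itself and the identity is trivial. For the vanishing, a strict
   descent at [z] is excluded, a missing up-step gives zero, and a last [z] leaves a negative last
   entry. *)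
case E: (cvr_y1 k lam z) => [y1|]; last first.
  have h0 : cvr_h k lam z = 0%N by rewrite /cvr_h E.
  have cvrE : cvr k lam z = cvr_mu lam z.
    rewrite /cvr h0 E addr0; apply/rowP => i; rewrite !mxE eqxx -val_eqE /=.
    by congr (_ - _); rewrite addn0 ltnS -eqn_leq eq_sym.
  rewrite h0 cvrE mul0n; split=> [d|nPar d]; first by rewrite /tmul /= subn0.
  have [L0 Lk Ld] := Par_entry hlam; have nP := @cvr_mu_Par k l lam z hlam.
  move: E; rewrite /cvr_y1; case: insubP => [z1 zl z1E|zl].
    rewrite -!entryE [X in X < _](_ : _ = entry lam z.+1); last by congr entry.
    case: ifP => [Lz _|Lz up].
      by case/negP: nPar; apply: nP; [have := L0 z.+1; lia|rewrite Lz implybT].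
    have {}Lz : entry lam z = entry lam z.+1 by have := Ld z z.+1; lia.
    have [x [xs [p [p1 p2 p3 p4 p5]]]] := uppath_chain hlam zl Lz.
    by rewrite kschur_cvr_mu //; apply: (Hstair_up_None hlam zl Lz p1 p2 p3 p5 z1E).
  rewrite (cvr_mu_rowfun z hlam) kschur_rowfun; last first.
    by move=> i; have := Lk i; rewrite /lower; lia.
  have lz : l.-1 = z by have := ltn_ord z; lia.
  rewrite Hstair_last_neg ?lz //.
    by move=> i _; rewrite /rowstart /lower; have := Lk i; lia.
  case: (entry lam z =P 0) => [Lz|Lz]; first by rewrite /lower Lz; lia.
  case/negP: nPar; apply: nP; last by rewrite (negbTE zl).
  by have := L0 z; lia.
have [L0 Lk Ld] := Par_entry hlam.
move: (E); rewrite /cvr_y1; case: insubP => [z1 zl z1E|//].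
rewrite -!entryE [X in X < _](_ : _ = entry lam z.+1); last by congr entry.
case: ifP => // Lz up.
have {}Lz : entry lam z = entry lam z.+1 by have := Ld z z.+1; lia.
have [x [xs [p [p1 p2 p3 p4 p5]]]] := uppath_chain hlam zl Lz.
exact: (kschur_cvr hlam zl Lz p1 p2 p3 p4 p5 z1E up E).
Qed.
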